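(* For every $m$ and every $\pi\in\mathfrak S_m$, $$N_{\mathrm{Box}(2143)}(\Delta(\pi))=N_{\mathrm{Box}(2143)}(\pi).$$ In particular, $\pi$ avoids $\mathrm{Box}(2143)$ if and only if $\Delta(\pi)$ does.
   Context: $\mathfrak S_n$ is the set of permutations $\pi=\pi_1\cdots\pi_n$ of $\{1,\dots,n\}$. For $\tau\in\mathfrak S_k$, an occurrence of the boxed pattern $\mathrm{Box}(\tau)$ in $\pi\in\mathfrak S_n$ is a choice of positions $i_1<\cdots<i_k$ such that $\pi_{i_1}\cdots\pi_{i_k}$ is order-isomorphic to $\tau$ and there is no index $j\notin\{i_1,\dots,i_k\}$ with $i_1<j<i_k$ and $\min_r \pi_{i_r}<\pi_j<\max_r\pi_{i_r}$. $N_{\mathrm{Box}(\tau)}(\pi)$ is the number of occurrences of $\mathrm{Box}(\tau)$ in $\pi$; $\pi$ avoids $\mathrm{Box}(\tau)$ if this number is $0$. For $\pi=\pi_1\cdots\pi_m\in\mathfrak S_m$, the increasing doubling $\Delta(\pi)\in\mathfrak S_{2m}$ is the permutation $$\Delta(\pi)=(2\pi_1-1)(2\pi_1)\,(2\pi_2-1)(2\pi_2)\cdots(2\pi_m-1)(2\pi_m).$$ *)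

(* Defs.v *)
From mathcomp Require Import all_boot all_fingroup.

Set Implicit Arguments.
Unset Strict Implicit.
Unset Printing Implicit Defensive.

(* The word pi_1 ... pi_n is represented by pi : 'S_n with positions and values
   both shifted down by one: (pi i).+1 is the letter at 1-based position i.+1. *)

Section BoxedPattern.

(* Patterns are nonempty, so that the first and last chosen positions exist. *)
Variables (k n : nat) (tau : 'S_k.+1) (pi : 'S_n).

Implicit Type i : {ffun 'I_k.+1 -> 'I_n}.

Definition increasing i := [forall r : 'I_k.+1, forall s : 'I_k.+1, (r < s) ==> (i r < i s)].

Definition order_isomorphic i :=
  [forall r : 'I_k.+1, forall s : 'I_k.+1, (pi (i r) < pi (i s)) == (tau r < tau s)].

(* The default n exceeds every value of pi, hence is irrelevant to the min. *)
Definition min_value i : nat := \big[minn/n]_(r < k.+1) pi (i r).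

Definition max_value i : nat := \max_(r < k.+1) pi (i r).

Definition box_empty i :=
  [forall j : 'I_n, (j \notin codom i) ==>
     ~~ ((i ord0 < j < i ord_max) && (min_value i < pi j < max_value i))].

Definition box_occurrence i :=
  [&& increasing i, order_isomorphic i & box_empty i].

Definition box_count : nat := #|[set i | box_occurrence i]|.

Definition box_avoids : bool := box_count == 0.

End BoxedPattern.

Definition word2143 (r : 'I_4) : 'I_4 := inord (nth 0 [:: 1; 0; 3; 2] r).

Fact word2143_inj : injective word2143.
Proof.
move=> [[|[|[|[|?]]]] ?] [[|[|[|[|?]]]] ?] // /(congr1 val);
  rewrite /word2143 /= !inordK // => _; exact: val_inj.
Qed.

Definition p2143 : 'S_4 := perm word2143_inj.

Section Doubling.

Variables (m : nat) (pi : 'S_m).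

Fact half_subproof (p : 'I_m.*2) : p./2 < m.
Proof. by rewrite ltn_half_double. Qed.

Definition half_ord (p : 'I_m.*2) : 'I_m := Ordinal (half_subproof p).

Fact doubling_subproof (p : 'I_m.*2) :
  (pi (half_ord p)).*2 + odd p < m.*2.
Proof. by rewrite -ltn_half_double addnC half_bit_double. Qed.

(* With 0-based letters, (2 pi_i - 1)(2 pi_i) becomes (2 pi_i)(2 pi_i + 1), at
   the 0-based positions 2 i and 2 i + 1. *)
Definition doubling_fun (p : 'I_m.*2) : 'I_m.*2 :=
  Ordinal (doubling_subproof p).

Fact doubling_fun_inj : injective doubling_fun.
Proof.
move=> p q /(congr1 val) /= E.
have Eo : odd p = odd q.
  by move/(congr1 odd): E; rewrite !oddD !odd_double !oddb.
move: E; rewrite Eo => /addIn /double_inj /val_inj /perm_inj /(congr1 val) /= Eh.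
by apply: val_inj; rewrite /= -(odd_double_half p) Eo Eh odd_double_half.
Qed.

Definition increasing_doubling : 'S_m.*2 := perm doubling_fun_inj.

End Doubling.

(* Main.v *)
Require Import Defs.
From mathcomp Require Import all_boot all_fingroup.
From mathcomp Require Import zify.

(** In a pattern [2143] the outer letters are the extreme positions and the
    inner letters are the extreme values.  Hence no letter of an occurrence lies
    strictly inside its bounding box, and [Box(2143)] occurs at [a < b < c < d]
    when the order conditions hold and the open box is plainly empty
    ([boxed2143], [box_occurrence_boxed2143]).

    With positions and values counted from 0, position [h] becomes in the
    doubling the block of positions [2h, 2h+1], carrying the consecutive values
    [2 pi_h, 2 pi_h + 1] in this order.  The letters of an occurrence of
    [Box(2143)] lie in four different blocks: two letters in one block would be
    an ascent with no position and no value in between, whereas each ascent of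
    [2143] is separated by another letter, in position or in value.
    The twin of a letter, its companion in the block, must stay out of the box,
    and this forces the box to be the smallest one meeting the four blocks: its
    lower left letters [2] and [1] are second in their blocks, its upper right
    letters [4] and [3] are first ([boxed2143_doubling_parity]).  For the four
    letters so placed, a block has a letter inside the box exactly when its
    index is inside the box of [pi] ([boxed2143_doubling]).  So
    [lift_occurrence] is injective with every occurrence in the doubling as a
    value, and it preserves and reflects occurrences; the two counts agree. *)

Section Pattern2143.

Context {n : nat} (s : 'S_n).

Definition boxed2143 (a b c d : 'I_n) :=
  [&& a < b, b < c, c < d, s b < s a, s a < s d, s d < s c &
      [forall j : 'I_n, ~~ ((a < j < d) && (s b < s j < s c))]].

Lemma ord4P (r : 'I_4) :
  [\/ r = inord 0, r = inord 1, r = inord 2 | r = inord 3].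
Proof.
case: r => [[|[|[|[|?]]]] ?] //;
  [constructor 1|constructor 2|constructor 3|constructor 4];
  by apply: val_inj; rewrite /= inordK.
Qed.

Lemma p2143E (k : nat) : k < 4 ->
  p2143 (inord k) = nth 0 [:: 1; 0; 3; 2] k :> nat.
Proof.
move=> k4; rewrite permE /word2143 (inordK k4) inordK //.
by move: k k4 => [|[|[|[|]]]].
Qed.

Lemma ord0_inord : ord0 = inord 0 :> 'I_4.
Proof. by apply: val_inj; rewrite /= inordK. Qed.

Lemma ord_max_inord : ord_max = inord 3 :> 'I_4.
Proof. by apply: val_inj; rewrite /= inordK. Qed.

Lemma big_ord4 (R : Type) (idx : R) (op : R -> R -> R) (F : 'I_4 -> R) :
  \big[op/idx]_(r < 4) F r =
  op (F (inord 0)) (op (F (inord 1)) (op (F (inord 2)) (op (F (inord 3)) idx))).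
Proof.
rewrite !big_ord_recl big_ord0.
by congr (op (F _) (op (F _) (op (F _) (op (F _) _))));
  apply: val_inj; rewrite /= inordK.
Qed.

Lemma increasing_order_isomorphic2143 (i : {ffun 'I_4 -> 'I_n}) :
  increasing i && order_isomorphic p2143 s i =
  [&& i (inord 0) < i (inord 1), i (inord 1) < i (inord 2),
      i (inord 2) < i (inord 3), s (i (inord 1)) < s (i (inord 0)),
      s (i (inord 0)) < s (i (inord 3)) & s (i (inord 3)) < s (i (inord 2))].
Proof.
apply/idP/idP.
  case/andP=> /forallP inc /forallP iso.
  have lt_pos p q : p < q < 4 -> i (inord p) < i (inord q).
    case/andP=> pq q4; move/forallP/(_ (inord q))/implyP: (inc (inord p)).
    by rewrite !inordK ?(ltn_trans pq q4) //; apply.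
  have lt_val p q : p < 4 -> q < 4 ->
      nth 0 [:: 1; 0; 3; 2] p < nth 0 [:: 1; 0; 3; 2] q ->
      s (i (inord p)) < s (i (inord q)).
    move=> p4 q4; rewrite -!p2143E // => pq.
    by move/forallP/(_ (inord q))/eqP: (iso (inord p)) => ->.
  by rewrite !lt_pos // !lt_val.
case/and5P=> ab bc cd ba /andP[ad dc]; apply/andP; split.
  apply/forallP=> r; apply/forallP=> t.
  by case: (ord4P r) => ->; case: (ord4P t) => ->;
    rewrite !inordK //=; lia.
apply/forallP=> r; apply/forallP=> t.
by case: (ord4P r) => ->; case: (ord4P t) => ->;
  rewrite !p2143E //=; lia.
Qed.

(** The clause excusing the chosen positions is vacuous for [2143], as each of
    the four letters lies on the boundary of the box. *)
Lemma box_occurrence_boxed2143 (i : {ffun 'I_4 -> 'I_n}) :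
  box_occurrence p2143 s i =
  boxed2143 (i (inord 0)) (i (inord 1)) (i (inord 2)) (i (inord 3)).
Proof.
rewrite /box_occurrence andbA increasing_order_isomorphic2143 /boxed2143.
rewrite -!andbA; do 6!apply: andb_id2l => ?.
rewrite /box_empty ord0_inord ord_max_inord.
have -> : min_value s i = s (i (inord 1)).
  by rewrite /min_value big_ord4; have := ltn_ord (s (i (inord 1))); lia.
have -> : max_value s i = s (i (inord 2)).
  by rewrite /max_value big_ord4; lia.
apply: eq_forallb => j; apply/implyP/idP => [j_out|//].
apply/negP=> j_in; suff /j_out : j \notin codom i by rewrite j_in.
apply/codomP=> -[r j_r]; move: j_in; rewrite j_r.
by case: (ord4P r) => ->; lia.
Qed.

End Pattern2143.

Section Doubling2143.

Context {m : nat} (pi : 'S_m).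

Local Notation delta := (increasing_doubling pi).

Fact block_pos_subproof (e : bool) (h : 'I_m) : e + h.*2 < m.*2.
Proof. by rewrite -ltn_half_double half_bit_double. Qed.

Definition block_pos (e : bool) (h : 'I_m) : 'I_m.*2 :=
  Ordinal (block_pos_subproof e h).

Lemma block_pos_inj (e : bool) : injective (block_pos e).
Proof. by move=> h k /(congr1 val) /= /addnI /double_inj /val_inj. Qed.

Lemma block_pos_half (p : 'I_m.*2) : p = block_pos (odd p) (half_ord p).
Proof. by apply: val_inj; rewrite /= odd_double_half. Qed.

Lemma doubling_block_pos (e : bool) (h : 'I_m) :
  delta (block_pos e h) = e + (pi h).*2 :> nat.
Proof.
rewrite permE /= oddD odd_double addbF oddb addnC.
by congr (_ + (pi _).*2); apply: val_inj; rewrite /= half_bit_double.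
Qed.

(** If a letter were placed otherwise in its block, the other letter of that
    block would lie inside the box. *)
Lemma boxed2143_doubling_parity (e0 e1 e2 e3 : bool) (a b c d : 'I_m) :
  boxed2143 delta (block_pos e0 a) (block_pos e1 b)
                  (block_pos e2 c) (block_pos e3 d) ->
  [/\ e0, e1, ~~ e2 & ~~ e3].
Proof.
case/and5P; rewrite !doubling_block_pos /=.
move=> ab bc cd ba /and3P[ad dc /forallP empty].
(* Consecutive letters in one block would have consecutive values there, which
   the order 2143 excludes; so strict inequalities pass to the blocks. *)
have same (h k : 'I_m) : h = k :> nat -> pi h = pi k :> nat.
  by move/val_inj->.
have lt_ab : a < b by have := same a b; lia.
have lt_bc : b < c by have := same b c; lia.
have lt_cd : c < d by have := same c d; lia.
have neq_pi (h k : 'I_m) : h < k -> pi h != pi k :> nat.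
  by apply: contraTneq => /val_inj/perm_inj->; rewrite ltnn.
have lt_ba : pi b < pi a by have := neq_pi a b lt_ab; lia.
have lt_ad : pi a < pi d.
  by have := neq_pi a d (ltn_trans lt_ab (ltn_trans lt_bc lt_cd)); lia.
have lt_dc : pi d < pi c by have := neq_pi c d lt_cd; lia.
have twin e h := empty (block_pos e h).
split.
- by have := twin (~~ e0) a; rewrite doubling_block_pos /=; lia.
- by have := twin (~~ e1) b; rewrite doubling_block_pos /=; lia.
- by have := twin (~~ e2) c; rewrite doubling_block_pos /=; lia.
- by have := twin (~~ e3) d; rewrite doubling_block_pos /=; lia.
Qed.

(** The box in the doubling runs over positions from [2a+1] to [2d] and values
    from [2 pi_b + 1] to [2 pi_c], both excluded: exactly the blocks strictly
    between those of [a] and [d], and of [pi_b] and [pi_c]. *)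
Lemma boxed2143_doubling (a b c d : 'I_m) :
  boxed2143 delta (block_pos true a) (block_pos true b)
                  (block_pos false c) (block_pos false d) =
  boxed2143 pi a b c d.
Proof.
rewrite /boxed2143 !doubling_block_pos /=.
do 6!(congr (_ && _); first by lia).
apply/forallP/forallP => empty => [h|p].
  by move: (empty (block_pos true h)); rewrite doubling_block_pos /=; lia.
rewrite (block_pos_half p); move: (odd p) (half_ord p) => e h.
by move: (empty h); rewrite doubling_block_pos /=; lia.
Qed.

Definition lift_occurrence (i : {ffun 'I_4 -> 'I_m}) : {ffun 'I_4 -> 'I_m.*2} :=
  [ffun r : 'I_4 => block_pos (r < 2) (i r)].

Lemma lift_occurrence_inj : injective lift_occurrence.
Proof.
move=> i k /ffunP eq_ik; apply/ffunP=> r.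
by move: (eq_ik r); rewrite !ffunE => /block_pos_inj.
Qed.

Lemma box_occurrence_lift (i : {ffun 'I_4 -> 'I_m}) :
  box_occurrence p2143 delta (lift_occurrence i) = box_occurrence p2143 pi i.
Proof.
by rewrite !box_occurrence_boxed2143 !ffunE !inordK //= boxed2143_doubling.
Qed.

Lemma box_occurrence_doublingP (i : {ffun 'I_4 -> 'I_m.*2}) :
  box_occurrence p2143 delta i -> exists k, i = lift_occurrence k.
Proof.
rewrite box_occurrence_boxed2143 => occ.
exists [ffun r => half_ord (i r)].
suff par (r : 'I_4) : odd (i r) = (r < 2).
  by apply/ffunP=> r; rewrite !ffunE -par -block_pos_half.
move: occ.
rewrite (block_pos_half (i (inord 0))) (block_pos_half (i (inord 1))).
rewrite (block_pos_half (i (inord 2))) (block_pos_half (i (inord 3))).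
case/boxed2143_doubling_parity => odd0 odd1 /negbTE odd2 /negbTE odd3.
by case: (ord4P r) => ->; rewrite ?odd0 ?odd1 ?odd2 ?odd3 inordK.
Qed.

Lemma box_count_doubling : box_count p2143 delta = box_count p2143 pi.
Proof.
rewrite /box_count -(card_imset _ lift_occurrence_inj).
apply: eq_card => i; rewrite inE; apply/idP/imsetP => [occ | [k occ ->]].
  have [k i_k] := box_occurrence_doublingP _ occ.
  by exists k; rewrite // inE -box_occurrence_lift -i_k.
by rewrite box_occurrence_lift; rewrite inE in occ.
Qed.

End Doubling2143.

Theorem proposition7p6 (m : nat) (pi : 'S_m) :
  box_count p2143 (increasing_doubling pi) = box_count p2143 pi /\
  (box_avoids p2143 pi <-> box_avoids p2143 (increasing_doubling pi)).
Proof. by rewrite /box_avoids box_count_doubling. Qed.
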